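(* Let $f$ be an $O$-regularly varying function and $A\in\mathcal{S}$. Let $\square$ be any one of the asymptotic relations $\asymp,\ \gg,\ \ll,\ \succ,\ \prec$. If $s(x;A)\ \square\ f(x)$, then for every integer $d\geqslant 1$, $s_d(x;A)\ \square\ f(x)^d$.
   Context: $\mathcal{S}$ denotes the set of infinite subsets of $\mathbb{Z}_{\geqslant 0}$. For $A\in\mathcal{S}$, $r(n;A)=r_1(n;A)$ is the indicator of $n\in A$; for $d\geqslant 2$, $r_d(n;A)=\sum_{k_1+\dots+k_d=n} r(k_1;A)\cdots r(k_d;A)$. For real $x\geqslant0$, $s(x;A)=s_1(x;A)=|A\cap[0,x]|$, $s_d(x;A)=\sum_{0\leqslant n\leqslant x} r_d(n;A)$. A positive measurable function $f$ defined on some $[\alpha,+\infty)$ is $O$-regularly varying if $f(\lambda x)\asymp f(x)$ for every $\lambda>0$. As $x\to+\infty$: $f\ll g$ means $\limsup|f/g|<+\infty$, $f\gg g$ means $g\ll f$, $f\asymp g$ means both, $f\prec g$ means $f/g\to0$, $f\succ g$ means $g\prec f$. *)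

(* Defs.v *)
From HB Require Import structures.
From mathcomp Require Import all_boot all_order all_algebra finmap.
From mathcomp Require Import all_classical all_reals all_analysis.

Set Implicit Arguments.
Unset Strict Implicit.
Unset Printing Implicit Defensive.

Import Order.TTheory GRing.Theory Num.Theory.
Import numFieldNormedType.Exports.

Local Open Scope classical_set_scope.
Local Open Scope ring_scope.

Section Asymptotics.
Context {R : realType}.
Implicit Types f g : R -> R.

(* In the relations below a zero denominator gives quotient 0 ([x / 0 = 0]);
   all functions they are applied to here are eventually positive. *)
Definition asymp_ll f g : Prop :=
  (limf_esup (fun x => `|f x / g x|%:E) (pinfty_nbhs R) < +oo)%E.

Definition asymp_gg f g : Prop := asymp_ll g f.

Definition asymp_eq f g : Prop := asymp_ll f g /\ asymp_gg f g.

Definition asymp_prec f g : Prop := f x / g x @[x --> +oo] --> (0 : R).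

Definition asymp_succ f g : Prop := asymp_prec g f.

(* [f] is a total function, but only its values on [[alpha, +oo[] matter.
   Measurability is in the sense of Lebesgue: the domain carries the
   sigma-algebra of Caratheodory-measurable sets for the outer measure induced
   by interval length, the codomain the Borel sigma-algebra. *)
Definition O_regularly_varying f : Prop :=
  (exists alpha : R,
    (forall x, alpha <= x -> 0 < f x) /\
    measurable_fun
      (`[alpha, +oo[ : set (caratheodory_type ((@wlength R idfun)^*)%mu))
      (f : _ -> measurableTypeR R)) /\
  (forall lambda : R, 0 < lambda ->
    asymp_eq (fun x => f (lambda * x)) f).

End Asymptotics.

Definition rep (A : set nat) (n : nat) : nat := n \in A.

(* A decomposition n = k_1 + ... + k_d has all its terms in [{0, ..., n}]. *)
Definition repd (d : nat) (A : set nat) (n : nat) : nat :=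
  (\sum_(k : {ffun 'I_d -> 'I_n.+1} | \sum_(i < d) k i == n)
     \prod_(i < d) rep A (k i))%N.

Definition count_fun {R : realType} (A : set nat) (x : R) : nat :=
  #|` fset_set (A `&` [set n | n%:R <= x])|%fset.

Definition countd_fun {R : realType} (d : nat) (A : set nat) (x : R) : nat :=
  \sum_(n \in [set n : nat | n%:R <= x]) repd d A n.

(* Main.v *)
(** A [d]-tuple of elements of [A] whose entries are at most [x / d] has sum at
    most [x], and the entries of a tuple of sum at most [x] are at most [x];
    hence [s (x / d) ^ d <= s_d x <= s x ^ d]. The upper bound transfers [<<]
    and [prec]; the lower bound transfers [>>] and [succ], because
    [f (x / d)] and [f x] are comparable by O-regular variation. *)
Require Import Defs.
From HB Require Import structures.
From mathcomp Require Import all_boot all_order all_algebra.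
From mathcomp Require Import all_classical all_reals all_analysis.

Set Implicit Arguments.
Unset Strict Implicit.
Unset Printing Implicit Defensive.

Import Order.TTheory GRing.Theory Num.Theory.
Import numFieldNormedType.Exports.

Local Open Scope classical_set_scope.
Local Open Scope ring_scope.

(** * Counting tuples by their sum, over the naturals *)

Section Counting.
Implicit Types (A : set nat) (d m n : nat).
Local Open Scope nat_scope.

(* Lets sums over [{0, ..., m}]^d with different [m] be compared in a common
   index set. *)
Lemma sum_ffun_widen d m n (P : pred ('I_d -> nat)) (F : ('I_d -> nat) -> nat) :
  m <= n ->
  \sum_(k : {ffun 'I_d -> 'I_m.+1} | P (fun i => k i : nat))
     F (fun i => k i : nat) =
  \sum_(k : {ffun 'I_d -> 'I_n.+1} |
        P (fun i => k i : nat) && [forall i, k i <= m])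
     F (fun i => k i : nat).
Proof.
move=> mn.
have mn1 : m.+1 <= n.+1 by [].
pose h (k : {ffun 'I_d -> 'I_m.+1}) : {ffun 'I_d -> 'I_n.+1} :=
  [ffun i => widen_ord mn1 (k i)].
(* [inord] truncates faithfully only when every entry is at most [m], which is the extra filter on
   the right-hand side. *)
pose h' (k : {ffun 'I_d -> 'I_n.+1}) : {ffun 'I_d -> 'I_m.+1} :=
  [ffun i => inord (k i)].
have hE k : (fun i => h k i : nat) = (fun i => k i : nat).
  by apply/funext => i; rewrite ffunE.
rewrite [RHS](reindex_onto h h') => [|k /andP[_ /forallP km]]; last first.
  by apply/ffunP => i; apply/val_inj; rewrite !ffunE /= inordK ?ltnS.
apply: eq_big => [k|k _]; last by rewrite hE.
rewrite hE; have -> : [forall i, h k i <= m].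
  by apply/forallP => i; rewrite ffunE /= -ltnS.
have -> : h' (h k) == k.
  by apply/eqP/ffunP => i; apply/val_inj; rewrite !ffunE /= inordK.
by rewrite !andbT.
Qed.

Lemma leq_sum_ffun d n (k : {ffun 'I_d -> 'I_n}) i : k i <= \sum_(j < d) k j.
Proof. by rewrite (bigD1 i) //= leq_addr. Qed.

(** Tuples of sum at most [n] are grouped by their sum [m]. Each entry is at most [m], so letting
    entries range up to [n] adds no tuple. *)
Lemma sum_repd d A n :
  \sum_(m < n.+1) repd d A m =
  \sum_(k : {ffun 'I_d -> 'I_n.+1} | \sum_(i < d) k i <= n)
     \prod_(i < d) rep A (k i).
Proof.
rewrite (partition_big (fun k : {ffun 'I_d -> 'I_n.+1} =>
  inord (\sum_(i < d) k i) : 'I_n.+1) xpredT) //=.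
apply: eq_bigr => m _.
rewrite /repd (@sum_ffun_widen d m n (fun k => \sum_(i < d) k i == m)
  (fun k => \prod_(i < d) rep A (k i))); last by rewrite -ltnS.
apply: eq_bigl => k; apply/andP/andP => [[/eqP km _]|[kn /eqP km]].
  rewrite km -ltnS ltn_ord; split=> //.
  by apply/eqP/val_inj; rewrite /= inordK.
have km' : \sum_(i < d) k i = m by rewrite -km inordK.
split; first exact/eqP.
by apply/forallP => i; rewrite -km' leq_sum_ffun.
Qed.

(** Distributivity: expanding the power chooses one summand per factor. *)
Lemma expn_sum_rep d A n :
  (\sum_(m < n.+1) rep A m) ^ d =
  \sum_(k : {ffun 'I_d -> 'I_n.+1}) \prod_(i < d) rep A (k i).
Proof.
rewrite -(bigA_distr_bigA (fun (_ : 'I_d) (j : 'I_n.+1) => rep A j)).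
by rewrite prod_nat_const card_ord.
Qed.

Lemma sum_repd_le d A n :
  \sum_(m < n.+1) repd d A m <= (\sum_(m < n.+1) rep A m) ^ d.
Proof.
rewrite sum_repd expn_sum_rep big_mkcond; apply: leq_sum => k _.
by case: ifP.
Qed.

Lemma sum_repd_ge d A m n : m * d <= n -> 0 < d ->
  (\sum_(k < m.+1) rep A k) ^ d <= \sum_(k < n.+1) repd d A k.
Proof.
(* Both sides become sums over tuples with entries up to [n], which requires [m <= n]. *)
move=> mdn d0; have mn : m <= n by apply: leq_trans mdn; rewrite leq_pmulr.
rewrite sum_repd expn_sum_rep (@sum_ffun_widen d m n xpredT
  (fun k => \prod_(i < d) rep A (k i))) //.
rewrite big_mkcond [leqRHS]big_mkcond; apply: leq_sum => k _ /=.
case: ifP => // /forallP km; case: ifP => //.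
suff -> : \sum_(i < d) k i <= n by [].
apply: leq_trans mdn.
have -> : m * d = \sum_(i < d) m by rewrite sum_nat_const card_ord mulnC.
exact: leq_sum.
Qed.

End Counting.

(** * Passage to a real argument *)

Section RealCounting.
Context {R : realType}.
Implicit Types (A : set nat) (x : R) (d : nat).

Lemma nat_le_realE x : 0 <= x ->
  [set n : nat | n%:R <= x] = `I_(Num.truncn x).+1.
Proof. by move=> x0; apply/seteqP; split=> n /=; rewrite ltnS truncn_ge_nat. Qed.

Lemma count_funE A x : 0 <= x ->
  count_fun A x = (\sum_(n < (Num.truncn x).+1) rep A n)%N.
Proof.
move=> x0; rewrite /count_fun card_fset_sum1 nat_le_realE//.
rewrite -(fsbig_finite addn); last exact/finite_setIr/finite_II.
rewrite fsbig_mkcondl -fsbig_ord; apply: eq_bigr => i _.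
by rewrite /rep; case: (_ \in _).
Qed.

Lemma countd_funE d A x : 0 <= x ->
  countd_fun d A x = (\sum_(n < (Num.truncn x).+1) repd d A n)%N.
Proof. by move=> x0; rewrite /countd_fun nat_le_realE// -fsbig_ord. Qed.

Lemma countd_fun_le d A x : 0 <= x ->
  (countd_fun d A x)%:R <= (count_fun A x)%:R ^+ d :> R.
Proof.
by move=> x0; rewrite countd_funE// count_funE// -natrX ler_nat sum_repd_le.
Qed.

Lemma countd_fun_ge d A x : 0 <= x -> (0 < d)%N ->
  (count_fun A (d%:R^-1 * x))%:R ^+ d <= (countd_fun d A x)%:R :> R.
Proof.
move=> x0 d0; have dR : 0 < d%:R :> R by rewrite ltr0n.
have dx0 : 0 <= d%:R^-1 * x by rewrite mulr_ge0// invr_ge0 ltW.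
rewrite countd_funE// count_funE// -natrX ler_nat sum_repd_ge//.
(* With [m] the truncation of [x / d], the natural number [m * d] is at most the truncation of [x]
   as soon as [m * d <= x]. *)
rewrite truncn_ge_nat// natrM -ler_pdivlMr// [x / _]mulrC.
by rewrite -truncn_ge_nat.
Qed.

(** Keeps the denominators nonzero when the counting functions are divided into [f]. *)
Lemma count_fun_gt0 A : A !=set0 -> \forall x \near +oo, (0 < @count_fun R A x)%N.
Proof.
case=> a Aa; near=> x.
have x0 : 0 <= x by near: x; exact: nbhs_pinfty_ge.
have ax : (a < (Num.truncn x).+1)%N.
  by rewrite ltnS truncn_ge_nat//; near: x.
rewrite count_funE// (bigD1 (Ordinal ax)) //= /rep mem_set//.
Unshelve. all: by end_near. Qed.

End RealCounting.

(** * Transfer of asymptotic relations *)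

Section Asymptotics.
Context {R : realType}.
Implicit Types (f g u v : R -> R) (c K : R) (d : nat).

Lemma asymp_llP f g : asymp_ll f g <->
  exists2 C : R, 0 <= C & \forall x \near +oo, `|f x / g x| <= C.
Proof.
split=> [/ereal_inf_lt[_ [V FV <-] supV]|[C C0 FC]].
  (* The maximum with 0 excludes the value [-oo] of an empty supremum, so [fine] loses nothing. *)
  exists (fine (maxe 0%E (ereal_sup [set `|f x / g x|%:E | x in V]))).
    by rewrite fine_ge0// le_max lexx.
  apply: filterS FV => x Vx; rewrite -lee_fin fineK; last first.
    by rewrite ge0_fin_numE ?le_max ?lexx// gt_max supV ltry.
  by rewrite le_max ereal_sup_ubound ?orbT//; exists x.
apply: (@le_lt_trans _ _ C%:E); last exact: ltry.
apply: (@le_trans _ _ (ereal_sup [set `|f x / g x|%:E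
  | x in [set x | `|f x / g x| <= C]])).
  by apply: ereal_inf_lbound; exists [set x | `|f x / g x| <= C].
by apply: ge_ereal_sup => _ [x /= xC <-]; rewrite lee_fin.
Qed.

Lemma near_pinfty_scale c (P : set R) : 0 < c ->
  (\forall x \near +oo, P x) -> \forall x \near +oo, P (c * x).
Proof.
move=> c0 [M [_ MP]]; exists (c^-1 * M); split; first exact: num_real.
by move=> x; rewrite mulrC ltr_pdivrMr// mulrC => /MP.
Qed.

(** Serves both directions: [u / v] is [s / f] with [c = 1] for the upper bound, and [f / s] with
    [c = 1 / d] for the lower one. *)
Lemma asymp_ll_scale_exp u v f g c K d : 0 < c -> 0 <= K ->
  (\forall x \near +oo, 0 <= f x / g x <= K * (u (c * x) / v (c * x)) ^+ d) ->
  asymp_ll u v -> asymp_ll f g.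
Proof.
move=> c0 K0 fguv /asymp_llP[C C0 /(near_pinfty_scale c0) uvC].
apply/asymp_llP; exists (K * C ^+ d); first by rewrite mulr_ge0// exprn_ge0.
apply: filterS2 fguv uvC => x /andP[fg0 fguv] uvC.
rewrite ger0_norm//; apply: le_trans fguv _; apply: ler_wpM2l => //.
apply: le_trans (ler_norm _) _; rewrite normrX.
by apply: lerXn2r uvC; rewrite ?nnegrE.
Qed.

Lemma asymp_prec_scale_exp u v f g c K d : 0 < c -> (0 < d)%N ->
  (\forall x \near +oo, 0 <= f x / g x <= K * (u (c * x) / v (c * x)) ^+ d) ->
  asymp_prec u v -> asymp_prec f g.
Proof.
move=> c0 d0 fguv uv; apply: (squeeze_cvgr fguv); first exact: cvg_cst.
rewrite -[X in _ --> X](mulr0 K); apply: cvgMr.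
(* Positivity of [d] matters here, since [0 ^+ 0 = 1]. *)
have <- : (0 : R) ^+ d = 0 by rewrite expr0n gtn_eqF.
have cu : u (c * x) / v (c * x) @[x --> +oo] --> (0 : R).
  by move=> B /uv; exact: near_pinfty_scale.
exact: continuous_cvg (@exprn_continuous R d 0) cu.
Qed.

End Asymptotics.

(** * The two bounds on quotients, and the five relations *)

Section Main.
Context {R : realType}.
Variables (f : R -> R) (A : set nat) (d : nat).
Hypotheses (hf : O_regularly_varying f) (A0 : A !=set0) (d0 : (0 < d)%N).
Local Notation s := (fun x : R => (count_fun A x)%:R : R).
Local Notation sd := (fun x : R => (countd_fun d A x)%:R : R).

Lemma near_ORV_gt0 : \forall x \near +oo, 0 < f x.
Proof.
have [[a [fa _]] _] := hf.
by near=> x; apply: fa; near: x; exact/nbhs_pinfty_ge/num_real.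
Unshelve. all: by end_near. Qed.

Lemma countd_div_le : \forall x \near +oo,
  0 <= sd x / f x ^+ d <= 1 * (s (1 * x) / f (1 * x)) ^+ d.
Proof.
near=> x.
have x0 : 0 <= x by near: x; exact: nbhs_pinfty_ge.
have f0 : 0 < f x by near: x; exact: near_ORV_gt0.
rewrite !mul1r divr_ge0 ?exprn_ge0 ?(ltW f0)//= expr_div_n.
by rewrite ler_pM2r ?invr_gt0 ?exprn_gt0// countd_fun_le.
Unshelve. all: by end_near. Qed.

Lemma countd_div_ge : exists2 K : R, 0 <= K & \forall x \near +oo,
  0 <= f x ^+ d / sd x <= K * (f (d%:R^-1 * x) / s (d%:R^-1 * x)) ^+ d.
Proof.
have c0 : 0 < d%:R^-1 :> R by rewrite invr_gt0 ltr0n.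
(* O-regular variation at [lambda = 1 / d] bounds [f x / f (x / d)] by [C]; its [d]-th power is the
   constant [K]. *)
have [_ /(_ _ c0)[_ /asymp_llP[C C0 fC]]] := hf.
exists (C ^+ d); first exact: exprn_ge0.
near=> x.
have x0 : 0 <= x by near: x; exact: nbhs_pinfty_ge.
have f0 : 0 < f x by near: x; exact: near_ORV_gt0.
have fc0 : 0 < f (d%:R^-1 * x).
  by near: x; exact: (near_pinfty_scale c0 near_ORV_gt0).
have sc0 : 0 < s (d%:R^-1 * x).
  rewrite ltr0n; near: x.
  exact: (near_pinfty_scale c0 (count_fun_gt0 A0)).
have ssd := countd_fun_ge A x0 d0.
have sd0 : 0 < sd x by apply: lt_le_trans ssd; rewrite exprn_gt0.
rewrite divr_ge0 ?exprn_ge0 ?(ltW f0)//=.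
have fxC : f x <= C * f (d%:R^-1 * x).
  rewrite -ler_pdivrMr//; apply: le_trans (ler_norm _) _.
  by near: x; exact: fC.
(* Numerators are compared through [fxC], inverse denominators through [ssd]. *)
rewrite -exprMn mulrA expr_div_n; apply: ler_pM.
- by rewrite exprn_ge0// ltW.
- by rewrite invr_ge0 ltW.
- by apply: lerXn2r => //; rewrite nnegrE ?mulr_ge0// ltW.
- by rewrite lef_pV2 ?posrE ?exprn_gt0.
Unshelve. all: by end_near. Qed.

Lemma countd_ll : asymp_ll s f -> asymp_ll sd (fun x => f x ^+ d).
Proof. exact: asymp_ll_scale_exp ltr01 ler01 countd_div_le. Qed.

Lemma countd_prec : asymp_prec s f -> asymp_prec sd (fun x => f x ^+ d).
Proof. exact: asymp_prec_scale_exp ltr01 d0 countd_div_le. Qed.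

Lemma countd_gg : asymp_gg s f -> asymp_gg sd (fun x => f x ^+ d).
Proof.
have [K K0 le_K] := countd_div_ge.
by apply: asymp_ll_scale_exp K0 le_K; rewrite invr_gt0 ltr0n.
Qed.

Lemma countd_succ : asymp_succ s f -> asymp_succ sd (fun x => f x ^+ d).
Proof.
have [K K0 le_K] := countd_div_ge.
by apply: asymp_prec_scale_exp d0 le_K; rewrite invr_gt0 ltr0n.
Qed.

End Main.

Theorem theorem2p2 (R : realType) (f : R -> R) (A : set nat)
    (hf : O_regularly_varying f) (hA : infinite_set A)
    (sq : (R -> R) -> (R -> R) -> Prop)
    (hsq : [set asymp_eq; asymp_gg; asymp_ll; asymp_succ; asymp_prec] sq)
    (hs : sq (fun x => (count_fun A x)%:R) f) :
  forall d : nat, (1 <= d)%N ->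
    sq (fun x => (countd_fun d A x)%:R) (fun x => f x ^+ d).
Proof.
move=> d d0; have A0 := infinite_setN0 hA.
move: hsq hs => [[[[|]|]|]|] ->.
- by case=> sll sgg; split; [exact: countd_ll | exact: countd_gg].
- exact: countd_gg.
- exact: countd_ll.
- exact: countd_succ.
- exact: countd_prec.
Qed.
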